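(* Let $\boldsymbol N=(N_1,\dots,N_d)$ with $N_\alpha\ge1$ integers, $Y_1,\dots,Y_d>0$, $\lambda>0$, $\boldsymbol e^0\in\mathbb R^d\setminus\{0\}$, and let $L^{\boldsymbol k}\in\mathbb R^{d\times d}$, $\boldsymbol k\in\overline{\mathbb Z}^{\boldsymbol N}$, be positive-definite. With the notation of the context, the non-symmetric system of linear equations $$(\mathbf I+\mathbf B)\,\mathbf e=\mathbf e^0,\qquad \mathbf B=\mathbf F^{-1}\hat{\boldsymbol\Gamma}_\lambda\mathbf F(\mathbf L-\lambda\mathbf I),$$ for the unknown $\mathbf e\in\mathbb R^{d\times\boldsymbol N}$, is solvable by the Conjugate Gradient method for an initial vector $\mathbf e_{(0)}=\mathbf e^0+\widetilde{\mathbf e}$ with $\widetilde{\mathbf e}\in\mathcal E$. Moreover, the sequence of iterates $(\mathbf e_{(m)})_m$ is independent of the parameter $\lambda$.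
   Context: Index set: $\overline{\mathbb Z}^{\boldsymbol N}=\{\boldsymbol k\in\mathbb Z^d:\ -N_\alpha/2<k_\alpha\le N_\alpha/2,\ \alpha=1,\dots,d\}$. Block vectors are $\mathbf x=(x_\alpha^{\boldsymbol k})\in\mathbb R^{d\times\boldsymbol N}$ with $\alpha\in\{1,\dots,d\}$, $\boldsymbol k\in\overline{\mathbb Z}^{\boldsymbol N}$, with inner product $(\mathbf x,\mathbf y)=\sum_{\alpha}\sum_{\boldsymbol k}x_\alpha^{\boldsymbol k}y_\alpha^{\boldsymbol k}$. Block matrices $\mathbf A=[A_{\alpha\beta}^{\boldsymbol k\boldsymbol m}]$ act by $(\mathbf A\mathbf x)_\alpha^{\boldsymbol k}=\sum_{\beta=1}^d\sum_{\boldsymbol m\in\overline{\mathbb Z}^{\boldsymbol N}}A_{\alpha\beta}^{\boldsymbol k\boldsymbol m}x_\beta^{\boldsymbol m}$. $\mathbf I$ is the identity. $\mathbf L=[\delta_{\boldsymbol k\boldsymbol m}L_{\alpha\beta}^{\boldsymbol k}]$, where $L^{\boldsymbol k}$ is the value of the electric conductivity tensor at the $\boldsymbol k$-th grid point. $\mathbf e^0$ is the constant block vector with entries $(\mathbf e^0)_\alpha^{\boldsymbol k}=e^0_\alpha$ for all $\boldsymbol k$. Discrete Fourier transform: $\mathbf F=[\delta_{\alpha\beta}F^{\boldsymbol k\boldsymbol m}]$ with $$F^{\boldsymbol k\boldsymbol m}=\frac{|\mathcal Y|^{1/2}}{\prod_\alpha N_\alpha}\exp\Bigl(-\sum_{\alpha=1}^d2\pi\mathrm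 i\,\frac{k_\alpha m_\alpha}{N_\alpha}\Bigr),\qquad |\mathcal Y|=\prod_{\alpha=1}^d 2Y_\alpha ,$$ and $\mathbf F^{-1}$ is its inverse. $\hat{\boldsymbol\Gamma}_\lambda=[\delta_{\boldsymbol k\boldsymbol m}\hat\Gamma_{\alpha\beta}(\boldsymbol k)]$, where $\hat\Gamma(\boldsymbol 0)=0$ and, for $\boldsymbol k\neq\boldsymbol0$, $\hat\Gamma(\boldsymbol k)=\dfrac{\boldsymbol\xi\otimes\boldsymbol\xi}{\lambda\,\boldsymbol\xi\cdot\boldsymbol\xi}$ with $\boldsymbol\xi=\boldsymbol\xi(\boldsymbol k)=(k_\alpha/Y_\alpha)_{\alpha=1}^d$. $\mathbf P_{\mathcal E}=\lambda\mathbf F^{-1}\hat{\boldsymbol\Gamma}_\lambda\mathbf F$, and $\mathcal E=\{\mathbf P_{\mathcal E}\mathbf x:\mathbf x\in\mathbb R^{d\times\boldsymbol N}\}\subset\mathbb R^{d\times\boldsymbol N}$. ''Solvable by the Conjugate Gradient method'' means that the standard Conjugate Gradient recursion, applied to the system with the (non-symmetric) matrix $\mathbf A=\mathbf I+\mathbf B$, right-hand side $\mathbf b=\mathbf e^0$ and initial vector $\mathbf e_{(0)}$, converges to the solution (in exact arithmetic: it does not break down and reaches zero residual in finitely many steps). The recursion is: $\mathbf r_{(0)}=\mathbf b-\mathbf A\mathbf e_{(0)}$, $\mathbf p_{(0)}=\mathbf r_{(0)}$, and for $m=0,1,\dots$, as long as $\mathbf r_{(m)}\neq0$: $$a_m=\frac{(\mathbf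 r_{(m)},\mathbf r_{(m)})}{(\mathbf A\mathbf p_{(m)},\mathbf p_{(m)})},\quad \mathbf e_{(m+1)}=\mathbf e_{(m)}+a_m\mathbf p_{(m)},\quad \mathbf r_{(m+1)}=\mathbf r_{(m)}-a_m\mathbf A\mathbf p_{(m)},$$ $$b_m=\frac{(\mathbf r_{(m+1)},\mathbf r_{(m+1)})}{(\mathbf r_{(m)},\mathbf r_{(m)})},\quad \mathbf p_{(m+1)}=\mathbf r_{(m+1)}+b_m\mathbf p_{(m)}.$$
   Formalization: For even N_α the space E need not lie in R^{d×N} and the system may have no real solution; so vectors are taken complex with the Hermitian inner product, and iterates are real whenever E is real (e.g. all N_α odd). Positive-definite is read as symmetric positive-definite. *)

(* Defs.v *)
From HB Require Import structures.
From mathcomp Require Import all_boot all_order all_algebra.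
From mathcomp Require Import all_classical all_reals all_analysis.
From mathcomp Require Import zify.
From mathcomp Require Import complex.

Set Implicit Arguments.
Unset Strict Implicit.
Unset Printing Implicit Defensive.

Import Order.TTheory GRing.Theory Num.Theory.
Local Open Scope complex_scope.
Local Open Scope ring_scope.

(* - N_a / 2 < k_a <= N_a / 2 is written without fractions. *)
Definition in_grid (d : nat) (N : 'I_d -> nat) : pred {ffun 'I_d -> int} :=
  fun k => [forall a, - (N a)%:Z < k a *+ 2 <= (N a)%:Z].

Record grid (d : nat) (N : 'I_d -> nat) := Grid {
  coord :> {ffun 'I_d -> int};
  coordP : in_grid N coord
}.

HB.instance Definition _ d N := [isSub for @coord d N].
HB.instance Definition _ d N := [Countable of @grid d N by <:].

Section GridFinite.
Variables (d : nat) (N : 'I_d -> nat).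

Definition grid_bound : nat := ((\sum_a N a)%N).*2.

Definition grid_encode (k : grid N) : {ffun 'I_d -> 'I_grid_bound.+1} :=
  [ffun a => inord (absz (k a + (N a)%:Z))].

Definition grid_decode (j : {ffun 'I_d -> 'I_grid_bound.+1}) :
  option (grid N) := insub [ffun a => (j a)%:Z - (N a)%:Z].

Lemma grid_encodeK : pcancel grid_encode grid_decode.
Proof.
move=> k; rewrite /grid_decode.
suff -> : [ffun a => (grid_encode k a)%:Z - (N a)%:Z] = coord k by rewrite valK.
apply/ffunP => a; rewrite !ffunE.
have /forallP/(_ a) := valP k; rewrite mulr2n => /andP[lo hi].
have leN : (N a <= \sum_b N b)%N by rewrite (bigD1 a) //= leq_addr.
have aux (z : int) (n s : nat) : - n%:Z < z + z -> z + z <= n%:Z ->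
  (n <= s)%N -> (absz (z + n%:Z)%R < s.*2.+1)%N /\ (absz (z + n%:Z))%:Z - n%:Z = z.
  by lia.
by have [lt_b eq_z] := aux _ _ _ lo hi leN; rewrite inordK.
Qed.

HB.instance Definition _ : fintype.isFinite (grid N) :=
  PCanIsFinite grid_encodeK.

End GridFinite.

(* Block vectors and block matrices are ordinary vectors and matrices whose
   rows and columns are numbered through the finite type of the index pairs
   (alpha, k). *)
Definition bidx (d : nat) (N : 'I_d -> nat) : finType := ('I_d * grid N)%type.

Definition bsize (d : nat) (N : 'I_d -> nat) : nat := #|{: bidx N}|.

Definition bvec (T : Type) (d : nat) (N : 'I_d -> nat)
    (x : 'I_d -> grid N -> T) : 'cV[T]_(bsize N) :=
  \col_i x (enum_val i).1 (enum_val i).2.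

(* [A k m alpha beta] is the entry A_{alpha beta}^{k m}. *)
Definition bmx (T : Type) (d : nat) (N : 'I_d -> nat)
    (A : grid N -> grid N -> 'I_d -> 'I_d -> T) : 'M[T]_(bsize N) :=
  \matrix_(i, j) A (enum_val i).2 (enum_val j).2 (enum_val i).1 (enum_val j).1.

Definition posdef (R : numDomainType) (n : nat) (L : 'M[R]_n) : Prop :=
  L^T = L /\ forall x : 'cV[R]_n, x != 0 -> 0 < (x^T *m L *m x) 0 0.

Section Discretization.
Variables (R : realType) (d : nat) (N : 'I_d -> nat) (Y : 'I_d -> R).
Implicit Types (k m : grid N) (lambda : R).

Local Notation C := R[i].
Local Notation toC := (real_complex R).

Definition expi (t : R) : C := cos t +i* sin t.

Definition cell_volume : R := \prod_a (2 * Y a).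

Definition dft_coef k m : C :=
  (Num.sqrt cell_volume / ((\prod_a N a)%N)%:R)%:C
  * expi (- \sum_a 2 * pi * ((k a)%:~R * (m a)%:~R / (N a)%:R)).

Definition dft : 'M[C]_(bsize N) :=
  bmx (fun k m a b => (a == b)%:R * dft_coef k m).

Definition frequency k : 'cV[R]_d := \col_a ((k a)%:~R / Y a).

Definition Gamma_hat lambda k : 'M[R]_d :=
  let xi := frequency k in
  if [forall a, k a == 0] then 0
  else (lambda * (xi^T *m xi) 0 0)^-1 *: (xi *m xi^T).

Definition Gamma_block lambda : 'M[C]_(bsize N) :=
  bmx (fun k m a b => (k == m)%:R * (Gamma_hat lambda k a b)%:C).

Definition L_block (L : grid N -> 'M[R]_d) : 'M[C]_(bsize N) :=
  bmx (fun k m a b => (k == m)%:R * (L k a b)%:C).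

Definition e0_block (e0 : 'I_d -> R) : 'cV[C]_(bsize N) :=
  bvec (fun a (_ : grid N) => (e0 a)%:C).

Definition P_E lambda : 'M[C]_(bsize N) :=
  toC lambda *: (invmx dft *m Gamma_block lambda *m dft).

Definition B_block lambda (L : grid N -> 'M[R]_d) : 'M[C]_(bsize N) :=
  invmx dft *m Gamma_block lambda *m dft *m (L_block L - (toC lambda)%:M).

(* The image of the real block vectors, seen inside the complex ones: if some
   N_a is even, P_E need not map real vectors to real vectors, because the
   grid is then not symmetric under k |-> - k. *)
Definition space_E lambda : set 'cV[C]_(bsize N) :=
  range (fun x : 'cV[R]_(bsize N) => P_E lambda *m map_mx toC x).

Definition real_vectors : set 'cV[C]_(bsize N) :=
  range (fun x : 'cV[R]_(bsize N) => map_mx toC x).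

End Discretization.

Arguments dft {R d} N Y.
Arguments Gamma_block {R d} N Y lambda.
Arguments L_block {R d N} L.
Arguments P_E {R d} N Y lambda.
Arguments B_block {R d N} Y lambda L.
Arguments space_E {R d} N Y lambda.
Arguments real_vectors R {d} N.

Section ConjugateGradient.
Variables (F : numClosedFieldType) (n : nat).
Implicit Types (A : 'M[F]_n) (b x y : 'cV[F]_n).

(* On real vectors this is the Euclidean inner product \sum_i x_i y_i. *)
Definition dotc x y : F := \sum_i x i 0 * (y i 0)^*.

Record cg_state := CGState {
  cg_e : 'cV[F]_n;
  cg_r : 'cV[F]_n;
  cg_p : 'cV[F]_n
}.

Definition cg_init A b x : cg_state :=
  let r := b - A *m x in CGState x r r.

(* The recursion stops at the first zero residual; from then on the state is
   repeated. *)
Definition cg_step A (s : cg_state) : cg_state :=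
  let: CGState e r p := s in
  if r == 0 then s else
  let a := dotc r r / dotc (A *m p) p in
  let r' := r - a *: (A *m p) in
  let b := dotc r' r' / dotc r r in
  CGState (e + a *: p) r' (r' + b *: p).

Definition cg_run A b x (m : nat) : cg_state :=
  iter m (cg_step A) (cg_init A b x).

Definition cg_iterate A b x (m : nat) : 'cV[F]_n := cg_e (cg_run A b x m).

(* No division by zero occurs before the residual vanishes, and the iterate at
   which it vanishes is the unique solution of the system. *)
Definition cg_solvable A b x : Prop :=
  exists M : nat,
    [/\ forall m, (m < M)%N ->
          cg_r (cg_run A b x m) != 0 /\
          dotc (A *m cg_p (cg_run A b x m)) (cg_p (cg_run A b x m)) != 0,
        cg_r (cg_run A b x M) = 0
      & forall y, A *m y = b <-> y = cg_iterate A b x M].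

End ConjugateGradient.

(* Main.v *)
(* [P = P_E] is an orthogonal projection independent of [lambda], because the
   DFT matrix is a multiple of a unitary one, and it kills the constant vector
   [b]. Hence [A = 1 - P + lambda^-1 P L], the initial residual lies in the
   range of [P], and there [A] coincides with the Hermitian positive definite
   operator [lambda^-1 P L P]. The recursion never leaves this subspace, so the
   residuals are pairwise orthogonal and must vanish in finitely many steps.
   Changing [lambda] multiplies residuals and directions by a common factor,
   which cancels in the iterates. *)
Require Import Defs.
From mathcomp Require Import all_boot all_order all_algebra.
From mathcomp Require Import all_classical all_reals all_analysis.
From mathcomp Require Import complex.
From mathcomp Require Import ring lra zify.
Import Order.TTheory GRing.Theory Num.Theory.
Local Open Scope classical_set_scope.
Local Open Scope ring_scope.

(** * Hermitian inner product and orthogonal families *)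

Section InnerProduct.
Context {F : numClosedFieldType} {n : nat}.
Implicit Types (x y z : 'cV[F]_n) (c : F).

Lemma dotcDl x y z : dotc (x + y) z = dotc x z + dotc y z.
Proof. by rewrite /dotc -big_split; apply: eq_bigr => i _;
  rewrite mxE mulrDl. Qed.

Lemma dotcDr x y z : dotc x (y + z) = dotc x y + dotc x z.
Proof.
by rewrite /dotc -big_split; apply: eq_bigr => i _; rewrite mxE rmorphD mulrDr.
Qed.

Lemma dotcZl c x y : dotc (c *: x) y = c * dotc x y.
Proof. by rewrite /dotc mulr_sumr; apply: eq_bigr => i _;
  rewrite mxE mulrA. Qed.

Lemma dotcZr c x y : dotc x (c *: y) = c^* * dotc x y.
Proof.
by rewrite /dotc mulr_sumr; apply: eq_bigr => i _; rewrite mxE rmorphM mulrCA.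
Qed.

Lemma dotcNl x y : dotc (- x) y = - dotc x y.
Proof. by rewrite -scaleN1r dotcZl mulN1r. Qed.

Lemma dotcBl x y z : dotc (x - y) z = dotc x z - dotc y z.
Proof. by rewrite dotcDl dotcNl. Qed.

Lemma dotcBr x y z : dotc x (y - z) = dotc x y - dotc x z.
Proof. by rewrite -scaleN1r dotcDr dotcZr rmorphN1 mulN1r. Qed.

Lemma dot0c x : dotc 0 x = 0.
Proof. by rewrite -(scale0r 0) dotcZl mul0r. Qed.

Lemma dotcC x y : dotc x y = (dotc y x)^*.
Proof.
rewrite /dotc rmorph_sum; apply: eq_bigr => i _ /=;
  by rewrite rmorphM /= conjCK mulrC.
Qed.

Lemma dotc_eq0 x : (dotc x x == 0) = (x == 0).
Proof.
rewrite /dotc psumr_eq0; last by move=> i _; exact: mul_conjC_ge0.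
apply/allP/eqP => [x0 | -> i _]; last by rewrite mxE mul0r eqxx.
apply/colP => i; rewrite mxE; apply/eqP.
by have := x0 i (mem_index_enum i); rewrite mul_conjC_eq0.
Qed.

Lemma dotcE x y : dotc x y = ((map_mx Num.conj y)^T *m x) 0 0.
Proof. by rewrite /dotc mxE; apply: eq_bigr => i _; rewrite !mxE mulrC. Qed.

Lemma dotc_adjoint (A : 'M[F]_n) x y :
  dotc (A *m x) y = dotc x ((map_mx Num.conj A)^T *m y).
Proof.
rewrite !dotcE map_mxM trmx_mul -map_trmx trmxK mulmxA;
  congr ((_ *m _ *m _) _ _).
by apply/matrixP => i j; rewrite !mxE /= conjCK.
Qed.

(** The Gram matrix of the family is diagonal with nonzero entries, hence of rank [m]; having [V] as
    a factor, its rank is at most that of [V], so at most [n]. *)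
Lemma orthogonal_family_size m (v : 'I_m -> 'cV[F]_n) :
  (forall i, v i != 0) -> (forall i j, i != j -> dotc (v i) (v j) = 0) ->
  (m <= n)%N.
Proof.
move=> v0 ortho; pose V := \matrix_(i < m, j < n) v i j 0.
suff gram : V *m (map_mx Num.conj V)^T = diag_mx (\row_i dotc (v i) (v i)).
  have : V *m (map_mx Num.conj V)^T \in unitmx.
    rewrite gram unitmxE det_diag unitfE; apply/prodf_neq0 => i _.
    by rewrite mxE dotc_eq0 v0.
  move=> /mxrank_unit <-.
  exact: leq_trans (mxrankM_maxl _ _) (rank_leq_col _).
apply/matrixP => i j; rewrite !mxE.
under eq_bigr do rewrite !mxE.
by rewrite -/(dotc _ _); case: eqVneq => [-> // | /ortho].
Qed.
End InnerProduct.

(** * Conjugate Gradient on an invariant subspace where the matrix is Hermitian positive definite *)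

Section ConjugateGradientOnSubspace.
Context {F : numClosedFieldType} {n : nat}.
Variables (A : 'M[F]_n) (b x : 'cV[F]_n) (S : 'cV[F]_n -> Prop).
Hypothesis S_lin : forall c u v, S u -> S v -> S (c *: u + v).
Hypothesis S_A : forall u, S u -> S (A *m u).
Hypothesis A_herm : forall u v, S u -> S v -> dotc (A *m u) v = dotc u (A *m v).
Hypothesis A_pos : forall u, S u -> u != 0 -> 0 < dotc (A *m u) u.
Hypothesis S_res : S (b - A *m x).

Local Notation r m := (cg_r (cg_run A b x m)).
Local Notation p m := (cg_p (cg_run A b x m)).
Local Notation e m := (cg_e (cg_run A b x m)).
Local Notation alpha m := (dotc (r m) (r m) / dotc (A *m p m) (p m)).
Local Notation beta m := (dotc (r m.+1) (r m.+1) / dotc (r m) (r m)).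

Lemma cg_run_succ m : r m != 0 ->
  [/\ e m.+1 = e m + alpha m *: p m,
      r m.+1 = r m - alpha m *: (A *m p m)
    & p m.+1 = r m.+1 + beta m *: p m].
Proof.
rewrite /cg_run iterS; case: (iter m _ _) => e0 r0 p0 /= /negPf r0_neq0.
by rewrite r0_neq0.
Qed.

(** The update of [r] is minus [A] applied to the update of [e]. This turns a vanishing recursive
    residual into a solution of the system. *)
Lemma cg_residual m : r m = b - A *m e m.
Proof.
elim: m => [// | m IH]; have [r0 | /cg_run_succ[-> -> _]] := eqVneq (r m) 0.
  move: r0 IH; rewrite /cg_run iterS; case: (iter m _ _) => e0 r0 p0 /= -> /=.
  by rewrite eqxx.
by rewrite IH mulmxDr -scalemxAr opprD addrA.
Qed.

Lemma cg_in_subspace m : S (r m) /\ S (p m).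
Proof.
elim: m => [// | m [Sr Sp]]; have [r0 | /cg_run_succ[_ -> ->]] := eqVneq (r m)
  0.
  move: r0 Sr Sp; rewrite /cg_run iterS; case: (iter m _ _) => e0 r0 p0 /= ->
    /=.
  by rewrite eqxx.
have Sr' : S (r m - alpha m *: (A *m p m)).
  by rewrite addrC -scaleNr; apply/S_lin/Sr/S_A.
by split=> //; rewrite addrC; apply: S_lin.
Qed.

(** The four relations support one another and need a single induction: residual orthogonality is
    what termination uses, and conjugacy of the directions keeps each new residual orthogonal to the
    old ones. *)
Lemma cg_orthogonality m : (forall j, (j < m)%N -> r j != 0) ->
  [/\ forall i, (i <= m)%N -> dotc (r i) (p i) = dotc (r i) (r i),
      forall i, (i < m)%N -> dotc (r m) (p i) = 0,
      forall i, (i < m)%N -> dotc (r m) (r i) = 0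
    & forall i, (i < m)%N -> dotc (A *m p i) (p m) = 0].
Proof.
elim: m => [| m IH] r_neq0; first by split=> // -[].
have [|rp rp0 rr0 Ap0] := IH; first by move=> j jm; apply/r_neq0/ltnW.
have Sp i : S (p i) := (cg_in_subspace i).2.
have Sr i : S (r i) := (cg_in_subspace i).1.
have rr_neq0 i : (i <= m)%N -> dotc (r i) (r i) != 0.
  by move=> im; rewrite dotc_eq0 r_neq0.
(* A zero direction would give [(r_i, r_i) = (r_i, p_i) = 0], so positivity of [A] on [S]
   applies. *)
have Ap_neq0 i : (i <= m)%N -> dotc (A *m p i) (p i) != 0.
  move=> im; rewrite gt_eqF // A_pos //; apply: contra_neq (rr_neq0 i im) => p0.
  by rewrite -rp // p0 dotcC dot0c rmorph0.
have alpha_neq0 i : (i <= m)%N -> alpha i != 0.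
  by move=> im; rewrite mulf_neq0 ?invr_eq0 ?rr_neq0 ?Ap_neq0.
(* For [i = m] this is the choice of [alpha]; for [i < m] both terms vanish by induction, after [A]
   is moved across the product. *)
have rp0' i : (i <= m)%N -> dotc (r m.+1) (p i) = 0.
  have [_ -> _] := cg_run_succ _ (r_neq0 m (ltnSn m)).
  rewrite leq_eqVlt dotcBl dotcZl => /predU1P[-> | im].
    by rewrite rp // divfK ?subrr ?Ap_neq0.
  have -> : dotc (A *m p m) (p i) = 0 by rewrite A_herm // dotcC Ap0 // rmorph0.
  by rewrite rp0 // mulr0 subrr.
have rr0' i : (i <= m)%N -> dotc (r m.+1) (r i) = 0.
  case: i => [_ | i im]; first exact: (rp0' 0%N).
  have [|_ _ defp] := cg_run_succ i; first exact/r_neq0/ltnW.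
  have -> : r i.+1 = p i.+1 - beta i *: p i by rewrite defp addrK.
  by rewrite dotcBr dotcZr !rp0' ?mulr0 ?subrr // ltnW.
(* Up to the nonzero factor [alpha i], the vector [A p_i] is a difference of consecutive residuals,
   which reduces conjugacy to orthogonality of residuals. *)
have ApE i : (i <= m)%N -> alpha i *: (A *m p i) = r i - r i.+1.
  by move=> /r_neq0/cg_run_succ[_ -> _]; rewrite opprB addrC subrK.
have [_ _ defp] := cg_run_succ _ (r_neq0 m (ltnSn m)).
split=> // [i | i im].
  rewrite leq_eqVlt => /predU1P[-> | /rp //].
  by rewrite {1}defp dotcDr dotcZr rp0' // mulr0 addr0.
apply: (mulfI (alpha_neq0 i im)); rewrite mulr0 defp dotcDr dotcZr mulrDr.
move: (im); rewrite ltnS leq_eqVlt => /predU1P[-> | lt_im]; last first.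
  rewrite Ap0 // !mulr0 addr0 -dotcZl ApE // dotcBl.
  by rewrite 2![dotc (r _) (r m.+1)]dotcC !rr0' ?rmorph0 ?subrr // ltnW.
(* Remaining case [i = m]: the first term is [- (r_{m+1}, r_{m+1})], and [beta] is chosen so that
   the second one cancels it. *)
rewrite -[alpha m * dotc _ (r m.+1)]dotcZl ApE // dotcBl [dotc (r m) _]dotcC
  rr0' // rmorph0 sub0r.
rewrite mulrCA divfK ?Ap_neq0 // rmorphM fmorphV /= -!dotcC divfK ?addNr //.
exact: rr_neq0.
Qed.

Lemma cg_breakdown_free m : (forall j, (j <= m)%N -> r j != 0) ->
  dotc (A *m p m) (p m) != 0.
Proof.
move=> r_neq0; have [|rp _ _ _] := cg_orthogonality m.
  by move=> j jm; apply/r_neq0/ltnW.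
rewrite gt_eqF // A_pos //; first exact: (cg_in_subspace m).2.
apply: contraNneq (r_neq0 m (leqnn m)) => p0.
by rewrite -dotc_eq0 -rp // p0 dotcC dot0c rmorph0.
Qed.

(** Otherwise [n + 1] residuals would be nonzero and pairwise orthogonal in dimension [n]. *)
Lemma cg_terminates : exists m, r m == 0.
Proof.
apply: contrapT => /forallNP r_neq0.
have r0 i : r i != 0 by apply/negP/r_neq0.
suff : (n.+1 <= n)%N by rewrite ltnn.
apply: (orthogonal_family_size n.+1 (fun i => r i)) => // i j.
wlog lt_ij : i j / (i < j)%N => [ortho | _].
  rewrite -(inj_eq val_inj) neq_ltn => /orP[lt_ij | lt_ji].
    by apply: ortho => //; rewrite -(inj_eq val_inj) ltn_eqF.
  by rewrite dotcC ortho ?rmorph0 // -(inj_eq val_inj) ltn_eqF.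
have [//|_ _ rr0 _] := cg_orthogonality j.
by rewrite dotcC rr0 ?rmorph0.
Qed.

(** [M] is the first index with zero residual. Positivity is known only on [S], so uniqueness among
    all vectors comes from invertibility of [A]. *)
Lemma cg_solvable_of_unit : A \in unitmx -> cg_solvable A b x.
Proof.
move=> A_unit; have [M /eqP rM0 minM] := ex_minnP cg_terminates.
have r_neq0 m : (m < M)%N -> r m != 0.
  by move=> mM; apply: contraTneq mM => /eqP/minM; rewrite leqNgt.
exists M; split=> // [m mM | y].
  by split; [exact: r_neq0|apply: cg_breakdown_free => j jm;
    apply/r_neq0/(leq_ltn_trans jm)].
have AeM : A *m e M = b.
  by apply/esym/eqP; rewrite -subr_eq0 -cg_residual rM0.
split=> [Ay | ->]; last exact: AeM.
by apply: (can_inj (mulKmx A_unit)); rewrite Ay AeM.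
Qed.

End ConjugateGradientOnSubspace.

(** * Conjugate Gradient for two matrices proportional on the subspace *)

Section ScaledConjugateGradient.
Context {F : numClosedFieldType} {n : nat}.
Variables (A A' : 'M[F]_n) (b x : 'cV[F]_n) (S : 'cV[F]_n -> Prop) (c : F).
Hypothesis S_lin : forall c u v, S u -> S v -> S (c *: u + v).
Hypothesis S_A : forall u, S u -> S (A *m u).
Hypothesis S_res : S (b - A *m x).
Hypothesis c_neq0 : c != 0.
Hypothesis c_real : c \is Num.real.
Hypothesis AE : forall u, S u -> A' *m u = c *: (A *m u).
Hypothesis resE : b - A' *m x = c *: (b - A *m x).

(* The factors [c] cancel in [a_m p_m] and in [b_m]. *)
Lemma cg_run_scale m :
  cg_run A' b x m =
    CGState (cg_e (cg_run A b x m)) (c *: cg_r (cg_run A b x m))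
            (c *: cg_p (cg_run A b x m)).
Proof.
elim: m => [|m IH]; first by rewrite /= /cg_init resE.
have [_] := cg_in_subspace A b x S S_lin S_A S_res m.
rewrite /cg_run !iterS -!/(cg_run _ _ _ _) IH.
case: (cg_run A b x m) => e r p /= Sp.
(* Since [c] is nonzero, both recursions stop at the same index. *)
rewrite scaler_eq0 (negPf c_neq0) /=; case: eqVneq => //= r0.
have cK q : c^-1 * q * c = q by rewrite mulrAC mulVf ?mul1r.
have alphaE : dotc (c *: r) (c *: r) / dotc (A' *m (c *: p)) (c *: p)
    = c^-1 * (dotc r r / dotc (A *m p) p).
  rewrite -scalemxAr AE // scalerA !dotcZl !dotcZr (conj_Creal c_real).
  (* A vanishing denominator is not excluded here; both sides are then 0, the inverse of 0 being
     0. *)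
  have [-> | t_neq0] := eqVneq (dotc (A *m p) p) 0;
    first by rewrite !(mulr0, invr0).
  by field; rewrite c_neq0 t_neq0.
have resE' : c *: r - (c^-1 * (dotc r r / dotc (A *m p) p)) *: (A' *m (c *: p))
    = c *: (r - (dotc r r / dotc (A *m p) p) *: (A *m p)).
  rewrite -scalemxAr AE // scalerA scalerBr !scalerA; congr (_ - _ *: _).
  by rewrite cK mulrC.
rewrite alphaE resE'; set r' := r - _; clearbody r'.
congr CGState; first by rewrite scalerA cK.
rewrite scalerDr !scalerA !dotcZl !dotcZr; congr (_ + _ *: _).
by rewrite -mulf_div divff ?mul1r 1?mulrC // -mulf_div divff ?mul1r //
  conjC_eq0.
Qed.

End ScaledConjugateGradient.

(** * Reality of the iterates for real data *)

Section RealConjugateGradient.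
Context {F : numClosedFieldType} {n : nat}.
Variables (A : 'M[F]_n) (b x : 'cV[F]_n).
Hypothesis A_real : A \is a mxOver Num.real.
Hypothesis b_real : b \is a mxOver Num.real.
Hypothesis x_real : x \is a mxOver Num.real.

Lemma dotc_real (u v : 'cV[F]_n) : u \is a mxOver Num.real ->
  v \is a mxOver Num.real -> dotc u v \is Num.real.
Proof.
move=> /mxOverP uR /mxOverP vR; apply: rpred_sum => i _.
by rewrite conj_Creal ?rpredM.
Qed.

Lemma mxOver_realD p q (u v : 'M[F]_(p, q)) : u \is a mxOver Num.real ->
  v \is a mxOver Num.real -> u + v \is a mxOver Num.real.
Proof.
by move=> /mxOverP uR /mxOverP vR; apply/mxOverP => i j; rewrite mxE rpredD.
Qed.

Lemma mxOver_realB p q (u v : 'M[F]_(p, q)) : u \is a mxOver Num.real ->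
  v \is a mxOver Num.real -> u - v \is a mxOver Num.real.
Proof.
by move=> /mxOverP uR /mxOverP vR; apply/mxOverP => i j; rewrite !mxE rpredB.
Qed.

(** The invariant must be reality of the whole state, since each new iterate depends on the residual
    and the direction. *)
Lemma cg_iterate_real m : cg_iterate A b x m \is a mxOver Num.real.
Proof.
suff [] : [/\ cg_e (cg_run A b x m) \is a mxOver Num.real,
    cg_r (cg_run A b x m) \is a mxOver Num.real
  & cg_p (cg_run A b x m) \is a mxOver Num.real] by [].
elim: m => [|m]; first by split=> //=; rewrite mxOver_realB ?mxOverM.
rewrite /cg_run iterS; case: (iter m _ _) => e r p /= [eR rR pR].
case: eqVneq => //= _.
have ApR : A *m p \is a mxOver Num.real by rewrite mxOverM.
have r'R : r - (dotc r r / dotc (A *m p) p) *: (A *m p) \is a mxOver Num.real.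
  by rewrite mxOver_realB // mxOverZ // rpred_div ?dotc_real.
by split=> //; rewrite mxOver_realD // mxOverZ // rpred_div ?dotc_real.
Qed.

End RealConjugateGradient.

(** * Complex exponentials of real angles *)

Section Characters.
Context {R : realType}.
Implicit Types (s t : R) (z : int).

Lemma expiD s t : expi (s + t) = expi s * expi t.
Proof. by rewrite /expi cosD sinD [sin s * _ + _]addrC. Qed.

Lemma expi0 : expi 0 = 1 :> R[i].
Proof. by rewrite /expi cos0 sin0. Qed.

Lemma expi_conj t : (expi t)^* = expi (- t).
Proof. by rewrite /expi cosN sinN. Qed.

Lemma expi_int z : expi (2 * pi * z%:~R) = 1 :> R[i].
Proof.
have nat_case n : expi (2 * pi * n%:R) = 1 :> R[i].
  elim: n => [|n IH]; first by rewrite mulr0 expi0.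
  by rewrite -[n.+1%:R]natr1 mulrDr expiD IH mul1r mulr1 /expi mulr_natl
    cos2pi sin2pi.
case: z => n; first exact: nat_case.
by rewrite NegzE rmorphN /= mulrN -expi_conj nat_case rmorph1.
Qed.

(** The real part is [1 - 2 sin^2(pi t)], and [sin(pi |t|) > 0] for [0 < |t| < 1]. *)
Lemma expi_neq1 t : 0 < `|t| < 1 -> expi (2 * pi * t) != 1.
Proof.
move=> /andP[t_gt0 t_lt1]; have pi0 := pi_gt0 R.
have sin_neq0 : sin (pi * t) != 0.
  have sin_abs : 0 < sin (pi * `|t|).
    by rewrite sin_gt0_pi // mulr_gt0 //= gtr_pMr.
  move: sin_abs; case: (ger0P t) => _; rewrite ?mulrN ?sinN => s0;
    first by rewrite gt_eqF.
  by rewrite -oppr_eq0 gt_eqF.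
apply: contra_neq sin_neq0 => -[+ _].
rewrite -mulrA mulr_natl cos_mulr2n cos2sin2 => s1.
apply/eqP; rewrite -sqrf_eq0; apply/eqP; lra.
Qed.

End Characters.

(** * Cyclic shifts of the grid and vanishing character sums *)

Section GridShift.
Context {d : nat} {N : 'I_d -> nat}.
Implicit Types (j k m : grid N).

Lemma grid_range k a : - (N a)%:Z < k a + k a /\ k a + k a <= (N a)%:Z.
Proof. by have /forallP/(_ a) := valP k; rewrite mulr2n => /andP. Qed.

(** A coordinate passing the upper end re-enters at the bottom. The default [j] of [insubd] is never
    reached when [N a >= 1]. *)
Definition grid_shift (a : 'I_d) j : grid N :=
  insubd j [ffun b => if b == a then
    if j a + 1 + (j a + 1) <= (N a)%:Z then j a + 1 else j a + 1 - (N a)%:Z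
    else j b].

Lemma grid_shiftE a j b : (1 <= N a)%N ->
  grid_shift a j b = if b == a then
    if j a + 1 + (j a + 1) <= (N a)%:Z then j a + 1 else j a + 1 - (N a)%:Z
    else j b.
Proof.
move=> N1; rewrite /grid_shift val_insubd ifT ?ffunE //.
apply/forallP => c; rewrite ffunE mulr2n.
have [ca jc] := (grid_range j a, grid_range j c).
by case: eqP => [-> | _]; [case: ifPn | ]; lia.
Qed.

Lemma grid_shift_inj a : (1 <= N a)%N -> injective (grid_shift a).
Proof.
move=> N1 j k jk; apply/val_inj/ffunP => b /=.
have := congr1 (fun l : grid N => l b) jk; rewrite !grid_shiftE //.
have [jr kr] := (grid_range j a, grid_range k a).
by case: eqP => [-> | //]; do 2 case: ifPn; lia.
Qed.

(* The shift of the grid by one step in direction [a] multiplies the sum by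
   [expi (2 * pi * (q a / N a))], which is not 1. *)
Lemma sum_character {R : realType} (q : 'I_d -> int) a :
  (forall b, 1 <= N b)%N -> q a != 0 -> `|q a| < (N a)%:Z ->
  \sum_(j : grid N) expi (\sum_b 2 * pi * ((j b)%:~R * (q b)%:~R / (N b)%:R))
    = 0 :> R[i].
Proof.
move=> N1 q0 qN.
pose chi (j : grid N) : R[i] :=
  expi (\sum_b 2 * pi * ((j b)%:~R * (q b)%:~R / (N b)%:R)).
rewrite -[LHS]/(\sum_j chi j).
have Na0 : (N a)%:R != 0 :> R by rewrite pnatr_eq0 -lt0n N1.
pose w : R[i] := expi (2 * pi * ((q a)%:~R / (N a)%:R)).
have chi_shift j : chi (grid_shift a j) = w * chi j.
  rewrite /chi /w (bigD1 a) //= grid_shiftE // eqxx [X in _ = _ * expi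
    X](bigD1 a) //=.
  under eq_bigr => b ba do rewrite grid_shiftE // (negPf ba).
  rewrite !expiD mulrA; congr (_ * _); rewrite -expiD.
  case: ifP => _; first by congr expi; rewrite rmorphD; field.
  (* After wrapping around, the angle differs by [2 pi q_a], a whole number of periods. *)
  rewrite -[LHS]mulr1 -(expi_int (q a)) -expiD; congr expi.
  by rewrite rmorphB rmorphD /= -pmulrn; field.
have w1 : w != 1.
  apply: expi_neq1; rewrite normrM normfV normr_nat divr_gt0 ?normr_gt0
    ?intr_eq0 ?ltr0n //=.
  by rewrite ltr_pdivrMr ?ltr0n // mul1r -intr_norm -[ltRHS]/((N a)%:Z%:~R)
    ltr_int.
have : \sum_j chi j = w * \sum_j chi j.
  by rewrite {1}(reindex_inj (grid_shift_inj a (N1 a))) mulr_sumr;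
    apply: eq_bigr.
move/eqP; rewrite -subr_eq0 -{1}[\sum_j _]mul1r -mulrBl mulf_eq0 subr_eq0.
by rewrite eq_sym (negPf w1) => /eqP.
Qed.

End GridShift.

(** * Products of block matrices *)

Section BlockAlgebra.
Context {T : comNzRingType} {d : nat} {N : 'I_d -> nat}.
Implicit Types (A B : grid N -> grid N -> 'I_d -> 'I_d -> T).

(** Removes the numbering of the index pairs, so that block products can be computed on entries. *)
Lemma sum_bidx (f : 'I_d -> grid N -> T) :
  \sum_(i < bsize N) f (enum_val i).1 (enum_val i).2 = \sum_k \sum_a f a k.
Proof.
rewrite exchange_big (pair_bigA _ (fun a k => f a k)) /=.
rewrite (reindex (@enum_rank (bidx N))) /=; last exact/onW_bij/enum_rank_bij.
by apply: eq_bigr => i _; rewrite enum_rankK.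
Qed.

Lemma bmxM A B :
  bmx A *m bmx B = bmx (fun k m a b => \sum_j \sum_e A k j a e * B j m e b).
Proof.
apply/matrixP => i i'; rewrite !mxE -sum_bidx.
by apply: eq_bigr => l _; rewrite !mxE.
Qed.

Lemma bmx_mul_bvec A (x : 'I_d -> grid N -> T) :
  bmx A *m bvec x = bvec (fun a k => \sum_j \sum_e A k j a e * x e j).
Proof.
apply/matrixP => i i'; rewrite !mxE -sum_bidx.
by apply: eq_bigr => l _; rewrite !mxE.
Qed.

Lemma eq_bmx A B : (forall k m a b, A k m a b = B k m a b) -> bmx A = bmx B.
Proof. by move=> AB; apply/matrixP => i j; rewrite !mxE AB. Qed.

Lemma bmx_scalar (c : T) :
  c%:M = bmx (fun (k m : grid N) a b => c * ((k == m)%:R * (a == b)%:R)).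
Proof.
apply/matrixP => i j; rewrite !mxE -[LHS]mulr_natr -natrM mulnb;
  congr (_ * _%:R).
by rewrite -(inj_eq enum_val_inj) andbC -xpair_eqE; case: (enum_val i);
  case: (enum_val j).
Qed.

Lemma bmx_diagM (D D' : grid N -> 'M[T]_d) :
  bmx (fun k m a b => (k == m)%:R * D k a b) *m
    bmx (fun k m a b => (k == m)%:R * D' k a b) =
  bmx (fun k m a b => (k == m)%:R * (D k *m D' k) a b).
Proof.
rewrite bmxM; apply: eq_bmx => k m a b; rewrite mxE mulr_sumr (bigD1 k) //=.
rewrite [X in _ + X]big1 ?addr0 => [|j /negPf jk]; last first.
  by apply: big1 => e _; rewrite eq_sym jk !mul0r.
by apply: eq_bigr => e _; rewrite eqxx mul1r mulrCA.
Qed.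

End BlockAlgebra.

Lemma bmx_adjoint {F : numClosedFieldType} {d : nat} {N : 'I_d -> nat}
    (A : grid N -> grid N -> 'I_d -> 'I_d -> F) :
  (map_mx Num.conj (bmx A))^T = bmx (fun k m a b => (A m k b a)^*).
Proof. by apply/matrixP => i j; rewrite !mxE. Qed.

(** * The Fourier matrix as a multiple of a unitary matrix *)

Section FourierMatrix.
Context {R : realType} {d : nat} {N : 'I_d -> nat} {Y : 'I_d -> R}.
Hypothesis N_ge1 : forall a, (1 <= N a)%N.
Hypothesis Y_gt0 : forall a, 0 < Y a.
Local Notation C := R[i].
Local Notation toC := (real_complex R).
Local Notation "A ^H" := (map_mx Num.conj A)^T (at level 8, format "A ^H").
Local Notation F := (dft N Y).
Local Notation coef := (@dft_coef R d N Y).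

Lemma conj_toC (t : R) : (toC t)^* = toC t.
Proof. by rewrite conj_Creal //; apply/complex_realP; exists t. Qed.

(** Common modulus of all Fourier coefficients. *)
Definition dft_scale : R := Num.sqrt (cell_volume Y) / ((\prod_a N a)%N)%:R.

Lemma dft_scale_gt0 : 0 < dft_scale.
Proof.
rewrite divr_gt0 ?sqrtr_gt0 ?ltr0n ?prodn_gt0 //.
by apply: prodr_gt0 => a _; rewrite mulr_gt0.
Qed.

Lemma dft_coefC k m : coef k m = coef m k.
Proof.
rewrite /dft_coef; congr (_ * expi (- _)); apply: eq_bigr => a _.
by rewrite [(k a)%:~R * _]mulrC.
Qed.

Lemma conj_coefM j k m : (coef j k)^* * coef j m = toC (dft_scale ^+ 2) *
  expi (\sum_a 2 * pi * ((j a)%:~R * (k a - m a)%:~R / (N a)%:R)).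
Proof.
rewrite /dft_coef -/dft_scale rmorphM /= conj_toC expi_conj opprK mulrACA.
rewrite -rmorphM -expr2 -expiD; congr (_ * expi _).
by rewrite -sumrB; apply: eq_bigr => a _; rewrite rmorphB /= mulrBr mulrBl
  mulrBr.
Qed.

(** For [k = m] the phases cancel and every summand is the same; otherwise the sum runs over a
    nontrivial character of frequency [k - m]. *)
Lemma dft_orthogonality k m :
  \sum_j (coef j k)^* * coef j m =
    (k == m)%:R * (toC (dft_scale ^+ 2) * #|{: grid N}|%:R).
Proof.
under eq_bigr do rewrite conj_coefM; rewrite -mulr_sumr mulrCA; congr (_ * _).
have [<- | km] := eqVneq k m.
  rewrite mul1r; under eq_bigr => j _.
    rewrite big1 ?expi0; first over; move=> a _.
    by rewrite subrr mulr0 mul0r mulr0.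
  by rewrite sumr_const.
rewrite mul0r; have [a kma] : exists a, k a != m a.
  apply/existsP; apply: contraNT km => /existsPn km.
  by apply/eqP/val_inj/ffunP => a; have /negPn/eqP := km a.
(* Both coordinates lie in a half-open interval of length [N a], so they differ by less than
   [N a]. *)
have [kr mr] := (grid_range k a, grid_range m a).
by apply: (sum_character (fun a => k a - m a) a) => //; lia.
Qed.

(** Squared norm of each column of the Fourier matrix. *)
Definition dft_gram : C := toC (dft_scale ^+ 2) * #|{: grid N}|%:R.

Fact grid0_subproof : in_grid N [ffun=> 0].
Proof. by apply/forallP => a; rewrite ffunE mul0rn oppr_lt0 ltz_nat lez_nat
  N_ge1 /=. Qed.

Definition grid0 : grid N := Grid grid0_subproof.

Lemma dft_gram_gt0 : 0 < dft_gram.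
Proof.
rewrite mulr_gt0 // ?ltr0n; last by apply/card_gt0P; exists grid0.
by rewrite ltcR exprn_gt0 // dft_scale_gt0.
Qed.

Lemma dft_adjM : F^H *m F = dft_gram%:M.
Proof.
rewrite bmx_adjoint bmxM bmx_scalar; apply: eq_bmx => k m a b.
rewrite mulrA -[dft_gram * _]mulrC -dft_orthogonality mulr_suml.
apply: eq_bigr => j _; rewrite (bigD1 a) //= big1 => [|e /negPf ea].
  by rewrite eqxx mul1r addr0 mulrCA mulrC.
by rewrite ea mul0r rmorph0 mul0r.
Qed.

Lemma dft_unit : F \in unitmx.
Proof.
have g0 : dft_gram != 0 by rewrite gt_eqF // dft_gram_gt0.
have := congr1 (fun M => dft_gram^-1 *: M) dft_adjM.
rewrite scale_scalar_mx mulVf // scalemxAl => /mulmx1_unit[] //.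
Qed.

Lemma dft_inv : invmx F = dft_gram^-1 *: F^H.
Proof.
have g0 : dft_gram != 0 by rewrite gt_eqF // dft_gram_gt0.
apply: (can_inj (mulmxK dft_unit)); rewrite mulVmx ?dft_unit //.
by rewrite -scalemxAl dft_adjM scale_scalar_mx mulVf.
Qed.

End FourierMatrix.

(** * The system reduced to an orthogonal projection [P] and a positive definite [K] *)

Section ProjectedSystem.
Context {F : numClosedFieldType} {n : nat}.
Local Notation "A ^H" := (map_mx Num.conj A)^T (at level 8, format "A ^H").
Variables (P K : 'M[F]_n) (b et : 'cV[F]_n).
Hypothesis P_idem : P *m P = P.
Hypothesis P_adj : P^H = P.
Hypothesis K_adj : K^H = K.
Hypothesis K_pos : forall v, v != 0 -> 0 < dotc (K *m v) v.
Hypothesis Pb : P *m b = 0.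
Hypothesis Pet : P *m et = et.

(** This is [I + B] expanded, with [B = l^-1 P (K - l)]. *)
Definition projected_mx (l : F) : 'M[F]_n := 1%:M - P + l^-1 *: (P *m K).

Lemma projected_mxE l (v : 'cV[F]_n) :
  projected_mx l *m v = v - P *m v + l^-1 *: (P *m (K *m v)).
Proof. by rewrite mulmxDl mulmxBl mul1mx -scalemxAl mulmxA. Qed.

(** The range of the idempotent [P], described by its fixed points so that membership is an
    equation. *)
Let S (v : 'cV[F]_n) := P *m v = v.

Let SE l v : S v -> projected_mx l *m v = l^-1 *: (P *m (K *m v)).
Proof. by move=> Sv; rewrite projected_mxE Sv subrr add0r. Qed.

(** As [P] kills [b] and fixes [et], the part [1 - P] maps [b + et] to [b], and only a vector in the
    range of [P] is left. *)
Let resE l : b - projected_mx l *m (b + et) = - (l^-1 *: (P *m (K *m (b +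
  et)))).
Proof.
by rewrite projected_mxE [P *m (b + et)]mulmxDr Pb Pet add0r addrK opprD addrA
  subrr add0r.
Qed.

Let S_image v : S (P *m v). Proof. by rewrite /S mulmxA P_idem. Qed.

Let S_scale c v : S v -> S (c *: v).
Proof. by move=> Sv; rewrite /S -scalemxAr Sv. Qed.

Let S_lin c u v : S u -> S v -> S (c *: u + v).
Proof. by move=> Su Sv; rewrite /S mulmxDr -scalemxAr Su Sv. Qed.

Let S_A l u : S u -> S (projected_mx l *m u).
Proof. by move=> Su; rewrite SE //; apply: S_scale. Qed.

Let S_res l : S (b - projected_mx l *m (b + et)).
Proof. by rewrite resE -scaleN1r; do 2 apply: S_scale. Qed.

Let dotc_P u v : S v -> dotc (P *m u) v = dotc u v.
Proof. by move=> Sv; rewrite dotc_adjoint P_adj Sv. Qed.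

(** If [A v = 0], applying [P] gives [P K v = 0], hence [v = P v] and [(K v, v) = (P K v, v) = 0],
    so [v = 0]. *)
Lemma projected_mx_unit l : l != 0 -> projected_mx l \in unitmx.
Proof.
(* Row-freeness concerns the left kernel; transposing turns it into the kernel on columns. *)
move=> l0; rewrite -unitmx_tr -row_free_unit; apply: inj_row_free => v.
move/(congr1 trmx); rewrite trmx_mul trmxK trmx0 => Av0.
apply: trmx_inj; rewrite trmx0; move: (v^T) Av0 => {}v Av0.
have PKv : P *m (K *m v) = 0.
  have := congr1 (mulmx P) Av0; rewrite projected_mxE mulmx0 mulmxDr mulmxBr.
  rewrite !mulmxA P_idem subrr add0r -scalemxAr !mulmxA P_idem => /eqP.
  by rewrite scaler_eq0 invr_eq0 (negPf l0) /= => /eqP.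
have Sv : S v.
  by move: Av0; rewrite projected_mxE PKv scaler0 addr0 => /eqP;
    rewrite subr_eq0 => /eqP.
apply: contra_eq (dotc_P (K *m v) v Sv) => v0.
by rewrite PKv dot0c eq_sym gt_eqF // K_pos.
Qed.

(** On the range of [P] the form [(A u, v)] equals [l^-1 (K u, v)], which inherits symmetry and
    positivity from [K]. *)
Lemma projected_cg_solvable l : 0 < l ->
  cg_solvable (projected_mx l) b (b + et).
Proof.
move=> l0; have lR : (l^-1)^* = l^-1 by rewrite conj_Creal // realV gtr0_real.
apply: (cg_solvable_of_unit _ _ _ S) => //.
- exact: S_A.
- move=> u v Su Sv; rewrite !SE // dotcZl dotcZr lR; congr (_ * _).
  by rewrite dotc_P // dotc_adjoint K_adj [RHS]dotcC dotc_P // -dotcC.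
- move=> u Su u0; rewrite SE // dotcZl dotc_P // mulr_gt0 ?invr_gt0 //.
  exact: K_pos.
- by rewrite projected_mx_unit ?gt_eqF.
Qed.

(** Passing from [l] to [l'] multiplies both the matrix on the range of [P] and the initial residual
    by [l / l']. *)
Lemma projected_cg_indep l l' m : 0 < l -> 0 < l' ->
  cg_iterate (projected_mx l') b (b + et) m =
  cg_iterate (projected_mx l) b (b + et) m.
Proof.
move=> l0 l'0; rewrite /cg_iterate.
have scaleE : l'^-1 = (l / l') * l^-1 by rewrite mulrAC divff ?mul1r ?gt_eqF.
have real_ratio : l / l' \is Num.real by rewrite gtr0_real // divr_gt0.
rewrite (cg_run_scale (projected_mx l) (projected_mx l') b (b + et) S (l /
  l')) //.
- exact: S_A.
- by rewrite gt_eqF // divr_gt0.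
- by move=> u Su; rewrite !SE // scalerA -scaleE.
- by rewrite !resE scalerN scalerA -scaleE.
Qed.

End ProjectedSystem.

Lemma conjugate_idem {T : comUnitRingType} n (U S : 'M[T]_n) : U \in unitmx ->
  S *m S = S ->
  (invmx U *m S *m U) *m (invmx U *m S *m U) = invmx U *m S *m U.
Proof. by move=> U_unit SS; rewrite !mulmxA mulmxK // -[_ *m S *m S]mulmxA SS.
  Qed.

(** * The projection [P_E] and its independence of [lambda] *)

Section Projection.
Context {R : realType} {d : nat} {N : 'I_d -> nat} {Y : 'I_d -> R}.
Hypothesis N_ge1 : forall a, (1 <= N a)%N.
Hypothesis Y_gt0 : forall a, 0 < Y a.
Local Notation C := R[i].
Local Notation toC := (real_complex R).
Local Notation "A ^H" := (map_mx Num.conj A)^T (at level 8, format "A ^H").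
Local Notation F := (dft N Y).
Local Notation coef := (@dft_coef R d N Y).

(** This is [lambda] times [Gamma_hat]: for nonzero [k], the orthogonal projection onto the line
    spanned by the frequency. *)
Definition symbol (k : grid N) : 'M[R]_d :=
  let xi := frequency Y k in
  if [forall a, k a == 0] then 0 else ((xi^T *m xi) 0 0)^-1 *: (xi *m xi^T).

Lemma symbol_tr k : (symbol k)^T = symbol k.
Proof.
rewrite /symbol; case: ifP => _; first by rewrite trmx0.
by rewrite linearZ /= trmx_mul trmxK.
Qed.

Lemma symbol_idem k : symbol k *m symbol k = symbol k.
Proof.
rewrite /symbol; case: ifPn => [_ | /forallPn[a ka]]; first by rewrite mulmx0.
set xi := frequency Y k; set s := (xi^T *m xi) 0 0.
have s0 : s != 0.
  rewrite gt_eqF // /s mxE (bigD1 a) //= ltr_pwDl //.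
    by rewrite !mxE -expr2 exprn_even_gt0 //= mulf_neq0 ?intr_eq0 // invr_eq0
      gt_eqF.
  by apply: sumr_ge0 => b _; rewrite !mxE -expr2 sqr_ge0.
rewrite -scalemxAl -scalemxAr mulmxA -[xi *m xi^T *m xi]mulmxA.
by rewrite [xi^T *m xi]mx11_scalar -/s mul_mx_scalar -scalemxAl scalerA [_ *
  s]mulrC divff ?scale1r.
Qed.

Definition symbol_block : 'M[C]_(bsize N) :=
  bmx (fun k m a b => (k == m)%:R * map_mx toC (symbol k) a b).

Definition proj : 'M[C]_(bsize N) := invmx F *m symbol_block *m F.

Lemma symbol_blockE (l : R) : l != 0 -> toC l *: Gamma_block N Y l =
  symbol_block.
Proof.
move=> l0; apply/matrixP => i j; rewrite !mxE mulrCA; congr (_ * _).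
rewrite -rmorphM /Gamma_hat /symbol; congr (_%:C)%C.
by case: ifP => _; rewrite !mxE ?mulr0 // invfM !mulrA divff ?mul1r.
Qed.

Lemma P_E_proj (l : R) : l != 0 -> P_E N Y l = proj.
Proof. by move=> l0; rewrite /P_E scalemxAl scalemxAr symbol_blockE. Qed.

Lemma symbol_block_idem : symbol_block *m symbol_block = symbol_block.
Proof.
rewrite (bmx_diagM (fun k => map_mx toC (symbol k)) (fun k => map_mx toC
  (symbol k))).
by apply: eq_bmx => k m a b; rewrite -map_mxM symbol_idem.
Qed.

Lemma diag_block_adj (D : grid N -> 'M[R]_d) : (forall k, (D k)^T = D k) ->
  let B : 'M[C]_(bsize N) := bmx (fun k m a b => (k == m)%:R * toC (D k a b)) in
  B^H = B.
Proof.
move=> D_sym B; rewrite bmx_adjoint; apply: eq_bmx => k m a b.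
rewrite rmorphM /= conj_toC rmorph_nat eq_sym; case: eqVneq => [-> | _];
  last by rewrite !mul0r.
by rewrite -{1}D_sym mxE.
Qed.

Lemma symbol_block_adj : symbol_block^H = symbol_block.
Proof.
have -> : symbol_block = bmx (fun k m a b => (k == m)%:R * toC (symbol k a b)).
  by apply: eq_bmx => k m a b; rewrite mxE.
exact/diag_block_adj/symbol_tr.
Qed.

Lemma proj_idem : proj *m proj = proj.
Proof.
by apply: conjugate_idem; [exact: dft_unit | exact: symbol_block_idem].
Qed.

(** With the adjoint in place of the inverse, self-adjointness and reality can be read off. *)
Lemma proj_dft_adj :
  proj = (dft_gram (N := N) (Y := Y))^-1 *: (F^H *m symbol_block *m F).
Proof. by rewrite /proj dft_inv // -!scalemxAl. Qed.

Lemma proj_adj : proj^H = proj.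
Proof.
rewrite {1}proj_dft_adj proj_dft_adj map_mxZ linearZ /= conj_Creal.
  rewrite !map_mxM !trmx_mul symbol_block_adj mulmxA;
    congr (_ *: (_ *m _ *m _)).
  by apply/matrixP => i j; rewrite !mxE /= conjCK.
by rewrite realV gtr0_real // dft_gram_gt0.
Qed.

(** The Fourier transform of a constant vector is supported at frequency zero, where the symbol
    vanishes. *)
Lemma proj_constant (e0 : 'I_d -> R) : proj *m e0_block N e0 = 0.
Proof.
rewrite /proj -!mulmxA (_ : symbol_block *m _ = 0) ?mulmx0 //.
rewrite /e0_block !bmx_mul_bvec; apply/matrixP => i z; rewrite !mxE.
move: (enum_val i).1 (enum_val i).2 => a k {i z}.
rewrite (bigD1 k) //= [X in _ + X]big1 ?addr0 => [|j jk]; last first.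
  by apply: big1 => e _; rewrite eq_sym (negPf jk) !mul0r.
apply: big1 => e _; rewrite eqxx mul1r mxE /symbol.
case: ifPn => [_ | /forallPn[c kc]]; first by rewrite mxE mul0r.
rewrite (_ : \sum_j _ = 0) ?mulr0 //.
rewrite (eq_bigr (fun m => coef m k * toC (e0 e))) => [|m _]; last first.
  rewrite (bigD1 e) //= big1 ?addr0 => [|f fe];
    first by rewrite eqxx mul1r dft_coefC.
  by rewrite eq_sym (negPf fe) !mul0r.
rewrite -mulr_suml; apply/eqP; rewrite mulf_eq0; apply/orP; left.
(* The Fourier mode of frequency zero is constant, so its orthogonality to mode [k] makes the sum of
   the coefficients of mode [k] vanish. *)
have coef0 m : (coef m (grid0 N_ge1))^* = toC (dft_scale (N := N) (Y := Y)).
  rewrite /dft_coef (_ : \sum_f _ = 0) ?oppr0 ?expi0 ?mulr1 ?conj_toC //.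
  apply: big1 => f _.
  by rewrite /= ffunE mulr0 mul0r mulr0.
have := dft_orthogonality (Y := Y) N_ge1 (grid0 N_ge1) k.
under eq_bigr do rewrite coef0; rewrite -mulr_sumr.
have /negPf -> : grid0 N_ge1 != k.
  by apply: contraNneq kc => <-; rewrite /= ffunE.
by move/eqP; rewrite mul0r mulf_eq0 fmorph_eq0 gt_eqF ?dft_scale_gt0.
Qed.

End Projection.

(** * Positivity of the conductivity block matrix on complex vectors *)

Section Positivity.
Context {R : realType}.
Local Notation C := R[i].
Local Notation toC := (real_complex R).

Lemma dotc_toC n (x y : 'cV[R]_n) :
  dotc (map_mx toC x) (map_mx toC y) = toC ((y^T *m x) 0 0).
Proof.
rewrite /dotc mxE rmorph_sum; apply: eq_bigr => i _.
by rewrite !mxE conj_toC rmorphM mulrC.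
Qed.

(** For [u = x + i y] the cross terms cancel by symmetry of [L], leaving the sum of the real forms
    at [x] and [y], one of which is positive. *)
Lemma posdef_complex n (L : 'M[R]_n) (u : 'cV[C]_n) : posdef L -> u != 0 ->
  0 < dotc (map_mx toC L *m u) u.
Proof.
case=> L_sym L_pos; pose x := map_mx (@complex.Re R) u;
  pose y := map_mx (@complex.Im R) u.
have -> : u = map_mx toC x + 'i%C *: map_mx toC y.
  by apply/matrixP => i j; rewrite !mxE -complexE.
have L_ge0 (z : 'cV[R]_n) : 0 <= (z^T *m (L *m z)) 0 0.
  by have [-> | z0] := eqVneq z 0; [rewrite !mulmx0 mxE | rewrite ltW //
    mulmxA L_pos].
have L_comm : (y^T *m (L *m x)) 0 0 = (x^T *m (L *m y)) 0 0.
  rewrite -[LHS]/((_ *m _) 0 0) -[(y^T *m _)]trmxK [LHS]mxE.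
  by rewrite !trmx_mul trmxK L_sym mulmxA.
have conj_i : ('i%C : C)^* = - 'i%C by apply/eqP;
  rewrite eq_complex /= oppr0 !eqxx.
rewrite mulmxDr -scalemxAr -!map_mxM !(dotcDl, dotcDr, dotcZl, dotcZr) conj_i
  !dotc_toC L_comm.
set xx := (x^T *m _) 0 0; set xy := (x^T *m _) 0 0; set yy := (y^T *m _) 0 0.
move=> u0; have -> : toC xx + - 'i%C * toC xy +
    ('i%C * toC xy + 'i%C * (- 'i%C * toC yy)) = toC (xx + yy).
  have i2 : 'i%C * 'i%C = -1 :> C by rewrite -expr2 sqr_i.
  by rewrite mulrA mulrN i2 opprK mul1r mulNr addrA subrK rmorphD.
rewrite ltcR.
have [x0 | x0] := eqVneq x 0; last first.
  by rewrite ltr_pwDl ?L_ge0 // /xx mulmxA L_pos.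
have [y0 | y0] := eqVneq y 0; last by rewrite ltr_wpDl ?L_ge0 // /yy mulmxA
  L_pos.
by move: u0; rewrite x0 y0 !map_mx0 scaler0 addr0 eqxx.
Qed.

(** The matrix is diagonal in the grid index, so the form is a sum of local forms over the grid
    points. *)
Lemma L_block_pos d (N : 'I_d -> nat) (L : grid N -> 'M[R]_d) v :
  (forall k, posdef (L k)) -> v != 0 -> 0 < dotc (L_block L *m v) v.
Proof.
move=> L_posdef v0.
pose u (k : grid N) : 'cV[C]_d := \col_a v (enum_rank (a, k)) 0.
have vE i : v i 0 = u (enum_val i).2 (enum_val i).1 0.
  by rewrite mxE -surjective_pairing enum_valK.
have -> : dotc (L_block L *m v) v = \sum_k dotc (map_mx toC (L k) *m u k) (u k).
  rewrite /dotc -(sum_bidx (fun a k => (map_mx toC (L k) *m u k) a 0 * (u k a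
    0)^*)).
  apply: eq_bigr => i _; rewrite -vE; congr (_ * _).
  have -> : v = bvec (fun a k => u k a 0) by apply/colP => j;
    rewrite [RHS]mxE vE.
  rewrite bmx_mul_bvec !mxE (bigD1 (enum_val i).2) //= [X in _ + X]big1 ?addr0.
    by apply: eq_bigr => e _; rewrite eqxx mul1r !mxE.
  by move=> j /negPf ji; apply: big1 => e _; rewrite eq_sym ji !mul0r.
have [k uk] : exists k, u k != 0.
  apply/existsP; apply: contraNT v0 => /existsPn u0; apply/eqP/colP => i.
  by rewrite vE; have /negPn/eqP -> := u0 (enum_val i).2; rewrite !mxE.
rewrite (bigD1 k) //= ltr_pwDl ?posdef_complex //; apply: sumr_ge0 => j _.
have [-> | uj] := eqVneq (u j) 0; first by rewrite mulmx0 dot0c.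
exact/ltW/posdef_complex.
Qed.

End Positivity.

(** * When the projection preserves real vectors *)

Section RealVectors.
Context {R : realType} {d : nat} {N : 'I_d -> nat} {Y : 'I_d -> R}.
Hypothesis N_ge1 : forall a, (1 <= N a)%N.
Hypothesis Y_gt0 : forall a, 0 < Y a.
Local Notation C := R[i].
Local Notation toC := (real_complex R).

Lemma toC_real m n (A : 'M[R]_(m, n)) : map_mx toC A \is a mxOver Num.real.
Proof. by apply/mxOverP => i j; rewrite mxE; apply/complex_realP;
  exists (A i j). Qed.

Lemma real_vectorsE (v : 'cV[C]_(bsize N)) :
  real_vectors R N v <-> v \is a mxOver Num.real.
Proof.
split=> [[x _ <-] | /mxOverP vR]; first exact: toC_real.
exists (map_mx (@complex.Re R) v) => //; apply/matrixP => i j; rewrite !mxE.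
exact: RRe_real.
Qed.

Lemma space_E_real (l : R) : l != 0 ->
  space_E N Y l `<=` real_vectors R N <-> proj (N := N) (Y := Y) \is a mxOver
    Num.real.
Proof.
move=> l0; split=> [E_real | PR v [x _ <-]]; last first.
  by apply/real_vectorsE; rewrite P_E_proj // mxOverM // toC_real.
apply/mxOverP => i j.
(* The image of the [j]-th unit vector is the [j]-th column of [proj]. *)
have /E_real/real_vectorsE/mxOverP/(_ i 0) :
    space_E N Y l (P_E N Y l *m map_mx toC (delta_mx j 0)).
  by exists (delta_mx j 0).
by rewrite P_E_proj // map_delta_mx -colE mxE.
Qed.

(** * Reflection symmetry of odd grids *)

Section OddGrid.
Hypothesis N_odd : forall a, odd (N a).

(** For odd [N a] the endpoint [N a / 2] is not an integer, so [- k] stays in the grid and the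
    default [k] is not reached. *)
Definition grid_opp (k : grid N) : grid N := insubd k [ffun a => - k a].

Lemma grid_oppE k a : grid_opp k a = - k a.
Proof.
rewrite /grid_opp val_insubd ifT ?ffunE //; apply/forallP => b;
  rewrite ffunE mulr2n.
have [lo hi] := grid_range k b; have := odd_double_half (N b); rewrite N_odd.
lia.
Qed.

Lemma grid_opp_inj : injective grid_opp.
Proof.
move=> j k jk; apply/val_inj/ffunP => a /=.
by apply: oppr_inj; rewrite -!grid_oppE jk.
Qed.

Lemma symbol_opp k : symbol (Y := Y) (grid_opp k) = symbol (Y := Y) k.
Proof.
have freqN : frequency Y (grid_opp k) = - frequency Y k.
  by apply/matrixP => a z; rewrite !mxE grid_oppE rmorphN mulNr.
have trN (v : 'cV[R]_d) : (- v)^T = - v^T by apply/matrixP => a z; rewrite !mxE.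
rewrite /symbol freqN trN !mulNmx !mulmxN !opprK.
by congr (if _ then _ else _); apply: eq_forallb => a;
  rewrite grid_oppE oppr_eq0.
Qed.

Lemma dft_coef_opp j k : @dft_coef R d N Y (grid_opp j) k = (dft_coef Y j k)^*.
Proof.
rewrite /dft_coef [RHS]rmorphM /= conj_toC expi_conj opprK; congr (_ * expi _).
rewrite -sumrN; apply: eq_bigr => a _.
by rewrite grid_oppE rmorphN !mulNr !mulrN opprK.
Qed.

(** Reflecting both summation frequencies conjugates the Fourier coefficients and fixes the symbol,
    so every entry equals its conjugate. *)
Lemma proj_real : proj (N := N) (Y := Y) \is a mxOver Num.real.
Proof.
rewrite proj_dft_adj // mxOverZ //; first by rewrite realV gtr0_real //
  dft_gram_gt0.
rewrite bmx_adjoint !bmxM; apply/mxOverP => i i'; rewrite mxE.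
move: (enum_val i).2 (enum_val i).1 (enum_val i').2 (enum_val i').1 => k a m b.
apply/CrealP; rewrite rmorph_sum [RHS](reindex_inj grid_opp_inj) /=.
apply: eq_bigr => j _; rewrite rmorph_sum; apply: eq_bigr => e _.
rewrite dft_coef_opp rmorphM /= [X in _ * X = _]rmorphM /= rmorph_nat.
congr (_ * _); rewrite rmorph_sum [RHS](reindex_inj grid_opp_inj) /=.
apply: eq_bigr => l _; rewrite rmorph_sum; apply: eq_bigr => f _.
rewrite dft_coef_opp (inj_eq grid_opp_inj) !mxE symbol_opp.
by rewrite !rmorphM /= conj_toC !rmorph_nat !conjCK.
Qed.

End OddGrid.
End RealVectors.

Theorem proposition1 (R : realType) (d : nat) (N : 'I_d -> nat)
    (Y : 'I_d -> R) (e0 : 'I_d -> R) (L : grid N -> 'M[R]_d)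
    (N_ge1 : forall a, (1 <= N a)%N) (Y_gt0 : forall a, 0 < Y a)
    (e0_neq0 : exists a, e0 a != 0) (L_posdef : forall k, posdef (L k)) :
  let A (lambda : R) : 'M[R[i]]_(bsize N) := 1%:M + B_block Y lambda L in
  let b := e0_block N e0 in
  forall (lambda : R) (et : 'cV[R[i]]_(bsize N)),
    0 < lambda -> space_E N Y lambda et ->
  [/\ cg_solvable (A lambda) b (b + et),
      forall mu : R, 0 < mu -> forall m : nat,
        cg_iterate (A mu) b (b + et) m = cg_iterate (A lambda) b (b + et) m,
      space_E N Y lambda `<=` real_vectors R N ->
        forall m : nat, real_vectors R N (cg_iterate (A lambda) b (b + et) m)
    & (forall a, odd (N a)) -> space_E N Y lambda `<=` real_vectors R N].
Proof.
move=> A b l et l0 Eet; set P := proj (N := N) (Y := Y).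
have PE mu : 0 < mu -> P_E N Y mu = P.
  by move=> mu0; rewrite P_E_proj // gt_eqF.
(* Here [B = mu^-1 P (L - mu)], whose second term is [- P]. *)
have AE mu : 0 < mu -> A mu = projected_mx P (L_block L) (real_complex R mu).
  move=> mu0; have toC_neq0 : real_complex R mu != 0 by rewrite fmorph_eq0
    gt_eqF.
  have BE : invmx (dft N Y) *m Gamma_block N Y mu *m dft N Y
      = (real_complex R mu)^-1 *: P.
    by rewrite -(PE _ mu0) /P_E scalerA mulVf // scale1r.
  rewrite /A /projected_mx /B_block BE -scalemxAl mulmxBr mul_mx_scalar.
  by rewrite scalerBr scalerA mulVf // scale1r addrA addrAC.
have Pb : P *m b = 0 by apply: proj_constant.
have Pet : P *m et = et.
  by case: Eet => x _ <-; rewrite PE // mulmxA proj_idem.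
have P_adj : (map_mx Num.conj P)^T = P by apply: proj_adj.
have K_adj : (map_mx Num.conj (L_block L))^T = L_block L.
  by apply: diag_block_adj => k; case: (L_posdef k).
have K_pos v : v != 0 -> 0 < dotc (L_block L *m v) v by apply: L_block_pos.
have P_idem : P *m P = P by apply: proj_idem.
have toC_gt0 mu : 0 < mu -> 0 < real_complex R mu by rewrite ltcR.
have realE : space_E N Y l `<=` real_vectors R N <-> P \is a mxOver Num.real.
  by apply: space_E_real => //; rewrite gt_eqF.
have P_real : (forall a, odd (N a)) -> P \is a mxOver Num.real.
  by move=> N_odd; apply: proj_real.
have cl0 := toC_gt0 _ l0.
(* From here on only the algebraic relations collected above are used. *)
clearbody A P.
split.
- by rewrite AE //; apply: projected_cg_solvable.
- move=> mu /[dup]/toC_gt0 cmu0 mu0 m.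
  rewrite (AE mu mu0) (AE l l0); exact: (projected_cg_indep P (L_block L) b et
    P_idem Pb Pet).
- move=> E_real m; apply/real_vectorsE.
  have PR : P \is a mxOver Num.real by apply/realE.
  have bR : b \is a mxOver Num.real.
    by apply/mxOverP => i j; rewrite mxE; apply/complex_realP; eexists.
  have etR : et \is a mxOver Num.real by apply/real_vectorsE/E_real.
  have KR : L_block L \is a mxOver Num.real.
    apply/mxOverP => i j; rewrite mxE rpredM ?rpred_nat //.
    by apply/complex_realP; eexists.
  apply: cg_iterate_real => //; last exact: mxOver_realD.
  rewrite AE // mxOver_realD // ?mxOver_realB // ?mxOver_scalar ?rpred1
    ?rpred0 //.
  by rewrite mxOverZ ?mxOverM // realV gtr0_real ?toC_gt0.
- by move/P_real/realE.
Qed.
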